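(* Let $m\ge 3$, $n\ge 2$, let $W_m$ be the wheel with $m$ rim vertices and $P_n$ the path on $n$ vertices, and let $\Delta$ be the maximum degree of $W_m\times P_n$. Then $$\chi''_{\Sigma}(W_m\times P_n)=\begin{cases}\Delta+1 & \text{if } n=3 \text{ and } m\ge 4,\\ \Delta+2 & \text{otherwise.}\end{cases}$$
   Context: All graphs are finite and simple. A proper total $k$-coloring of a graph $G$ assigns to every vertex and every edge a color from $\{1,\dots,k\}$ such that adjacent vertices receive different colors, edges sharing an endpoint receive different colors, and no edge receives the same color as either of its endpoints. For such a coloring $c$ and a vertex $v$, let $f(v)=c(v)+\sum_{e\ni v} c(e)$. The coloring distinguishes adjacent vertices by sums if $f(u)\neq f(v)$ for every edge $uv$. $\chi''_{\Sigma}(G)$ denotes the smallest $k$ such that $G$ has a proper total $k$-coloring distinguishing adjacent vertices by sums. The product $G_1\times G_2$ is the Cartesian product: vertex set $V(G_1)\times V(G_2)$, with $(u_1,u_2)$ adjacent to $(v_1,v_2)$ iff either $u_1=v_1$ and $u_2v_2\in E(G_2)$, or $u_1v_1\in E(G_1)$ and $u_2=v_2$. The wheel $W_m$ consists of a cycle on $m$ vertices together with a central vertex adjacent to all of them ($W_3=K_4$). *)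

(* Defs.v *)
From mathcomp Require Import all_boot.

Set Implicit Arguments.
Unset Strict Implicit.
Unset Printing Implicit Defensive.

Record sgraph := SGraph {
  vertex :> finType;
  adj : rel vertex;
  adj_sym : symmetric adj;
  adj_irr : irreflexive adj }.

Arguments adj : clear implicits.
Arguments adj {s} _ _.

Definition edges (G : sgraph) : {set {set G}} :=
  [set [set p.1; p.2] | p : G * G & adj p.1 p.2].

Definition degree (G : sgraph) (v : G) : nat := #|[set w | adj v w]|.

Definition max_degree (G : sgraph) : nat := \max_(v : G) degree v.

(* A total coloring is a pair of functions; only the values of [ce] on
   [edges G] are meaningful, and every condition below is restricted to them. *)
Definition proper_total_coloring (G : sgraph) (k : nat)
    (cv : G -> nat) (ce : {set G} -> nat) : Prop :=
  [/\ (forall v : G, 1 <= cv v <= k) /\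
        (forall e, e \in edges G -> 1 <= ce e <= k),
      forall u v : G, adj u v -> cv u <> cv v,
      forall (v : G) (e1 e2 : {set G}), e1 \in edges G -> e2 \in edges G ->
        e1 <> e2 -> v \in e1 -> v \in e2 -> ce e1 <> ce e2
    & forall (v : G) (e : {set G}), e \in edges G -> v \in e -> ce e <> cv v].

Definition color_sum (G : sgraph) (cv : G -> nat) (ce : {set G} -> nat)
    (v : G) : nat :=
  cv v + \sum_(e in edges G | v \in e) ce e.

Definition sum_distinguishing (G : sgraph) (cv : G -> nat)
    (ce : {set G} -> nat) : Prop :=
  forall u v : G, adj u v -> color_sum cv ce u <> color_sum cv ce v.

Definition sum_total_colorable (G : sgraph) (k : nat) : Prop :=
  exists (cv : G -> nat) (ce : {set G} -> nat),
    proper_total_coloring k cv ce /\ sum_distinguishing cv ce.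

(* [is_chi_sigma G k] means $\chi''_\Sigma(G) = k$. *)
Definition is_chi_sigma (G : sgraph) (k : nat) : Prop :=
  sum_total_colorable G k /\
  forall j : nat, sum_total_colorable G j -> k <= j.

Section CartesianProduct.
Variables G H : sgraph.

Definition cart_adj : rel (G * H) := fun x y =>
  (x.1 == y.1) && adj x.2 y.2 || adj x.1 y.1 && (x.2 == y.2).

Lemma cart_adj_sym : symmetric cart_adj.
Proof.
move=> x y; rewrite /cart_adj (eq_sym x.1) (eq_sym x.2).
by rewrite (adj_sym x.1) (adj_sym x.2).
Qed.

Lemma cart_adj_irr : irreflexive cart_adj.
Proof. by move=> x; rewrite /cart_adj !adj_irr andbF. Qed.

Definition cart_prod : sgraph := SGraph cart_adj_sym cart_adj_irr.
End CartesianProduct.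

Section Path.
Variable n : nat.

Definition path_adj : rel 'I_n := fun i j => (i.+1 == j) || (j.+1 == i).

Lemma path_adj_sym : symmetric path_adj.
Proof. by move=> i j; rewrite /path_adj orbC. Qed.

Lemma path_adj_irr : irreflexive path_adj.
Proof. by move=> i; rewrite /path_adj orbb gtn_eqF. Qed.

Definition path_graph : sgraph := SGraph path_adj_sym path_adj_irr.
End Path.

Section Wheel.
Variable m : nat.

(* [None] is the hub and [Some i] the rim vertices.  The test [i != j] only
   matters for [m = 1], where the cyclic successor of [i] is [i] itself. *)
Definition wheel_adj : rel (option 'I_m) := fun x y =>
  match x, y with
  | Some i, Some j => (i != j) && ((j == ordS i) || (i == ordS j))
  | None, None => false
  | _, _ => true
  end.

Lemma wheel_adj_sym : symmetric wheel_adj.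
Proof. by move=> [i|] [j|] //=; rewrite eq_sym orbC. Qed.

Lemma wheel_adj_irr : irreflexive wheel_adj.
Proof. by move=> [i|] //=; rewrite eqxx. Qed.

Definition wheel : sgraph := SGraph wheel_adj_sym wheel_adj_irr.
End Wheel.

(* Main.v *)
Require Import Defs.
From mathcomp Require Import all_boot zify.

Set Implicit Arguments.
Unset Strict Implicit.
Unset Printing Implicit Defensive.

(* Lower bound: a vertex of degree d sees d + 1 distinct colors, and if two
   adjacent vertices of degree d had only d + 1 colors at their disposal, both
   would see all of them and have equal sums.

   Upper bound: all layers carry the same coloring of the wheel edges, vertex
   colors alternate between two colorings, and all vertical edges between two
   consecutive layers get one large color.  Vertical edges then shift all sums of
   a layer by the same amount, so everything reduces to coloring one wheel.  With
   spokes 1, ..., m, the rim can be colored cyclically modulo m when m >= 5; the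
   cases m = 3 and m = 4 are explicit.  For n = 3 and m >= 4 one color is saved by
   letting the hubs of the outer layers reuse the vertical color they miss. *)

(** * Edges as unordered pairs, and the lower bound *)

Section Edges.
Variable G : sgraph.
Implicit Types (x y v w : G) (ce : {set G} -> nat).

Lemma adj_neq x y : adj x y -> x != y.
Proof. by apply: contraTneq => ->; rewrite adj_irr. Qed.

Lemma edge_in_edges x y : adj x y -> [set x; y] \in edges G.
Proof. by move=> xy; apply/imsetP; exists (x, y); rewrite ?inE. Qed.

Lemma edge_at (v : G) (E : {set G}) :
  E \in edges G -> v \in E -> exists2 w, adj v w & E = [set v; w].
Proof.
case/imsetP=> -[x y]; rewrite inE /= => xy ->; rewrite !inE => /orP[]/eqP->.
  by exists y.
by exists x; rewrite 1?adj_sym // setUC.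
Qed.

Lemma set2_cancel v x y : [set v; x] = [set v; y] -> v != x -> x = y.
Proof.
move=> eq_xy vx; have := set22 v x; rewrite eq_xy !inE eq_sym (negPf vx).
by move/eqP.
Qed.

Lemma edge_sum ce v :
  \sum_(e in edges G | v \in e) ce e = \sum_(w | adj v w) ce [set v; w].
Proof.
transitivity (\sum_(w in [set w | adj v w]) ce [set v; w]); last first.
  by apply: eq_bigl => w; rewrite inE.
rewrite -(@big_imset _ _ _ _ _ (fun w => [set v; w])) /=; last first.
  by move=> x y; rewrite !inE => /adj_neq vx _ /set2_cancel; apply.
apply: eq_bigl => e; apply/andP/imsetP => [[eG /(edge_at eG)[w vw ->]]|[w]].
  by exists w; rewrite ?inE.
by rewrite inE => vw ->; rewrite set21 edge_in_edges.
Qed.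

(** The picked orientation of [E] is arbitrary, so this is meaningful only for [c] symmetric on
    adjacent pairs; the value 0 off the edges is junk. *)
Definition edge_color (c : G -> G -> nat) (E : {set G}) : nat :=
  if [pick p : G * G | adj p.1 p.2 && (E == [set p.1; p.2])] is Some p
  then c p.1 p.2 else 0.

Lemma edge_colorE (c : G -> G -> nat) x y :
  (forall u w, adj u w -> c u w = c w u) -> adj x y ->
  edge_color c [set x; y] = c x y.
Proof.
move=> c_sym xy; rewrite /edge_color; case: pickP => [[u w] /=|/(_ (x, y))];
  last by rewrite xy eqxx.
case/andP=> uw /eqP eq_xy; have := set21 x y; rewrite eq_xy !inE.
case/orP=> /eqP xE; move: eq_xy (xy); rewrite xE => + {}xy.
  by move/set2_cancel => -> //; apply: adj_neq.
by rewrite [RHS]setUC => /set2_cancel -> //; [apply: c_sym | apply: adj_neq].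
Qed.

(** The form in which all colorings are constructed: edges are ordered pairs, and sums run over
    neighbors instead of sets. *)
Definition sum_coloring (k : nat) (cv : G -> nat) (c : G -> G -> nat) : Prop :=
  [/\ (forall v, 1 <= cv v <= k) /\ (forall u v, adj u v -> 1 <= c u v <= k),
      (forall u v, adj u v -> c u v = c v u) /\
        (forall u v, adj u v -> c u v <> cv u),
      forall u v, adj u v -> cv u <> cv v,
      forall v u w, adj v u -> adj v w -> u <> w -> c v u <> c v w
    & forall u v, adj u v ->
        cv u + \sum_(w | adj u w) c u w <> cv v + \sum_(w | adj v w) c v w].

Lemma sum_coloring_colorable k cv c :
  sum_coloring k cv c -> sum_total_colorable G k.
Proof.
case=> -[cvk ck] [c_sym c_cv] cv_adj c_adj sums.
have cE := edge_colorE c_sym.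
exists cv, (edge_color c); split; first split=> //.
- split=> // e /imsetP[[x y]]; rewrite inE /= => xy ->.
  by rewrite cE // ck.
- move=> v e1 e2 e1G e2G e12 /(edge_at e1G)[u vu e1E] /(edge_at e2G)[w vw e2E].
  rewrite e1E e2E !cE //; apply: c_adj => // uw.
  by apply: e12; rewrite e1E e2E uw.
- by move=> v e eG /(edge_at eG)[w vw ->]; rewrite cE //; apply: c_cv.
move=> u v uv; rewrite /color_sum !edge_sum.
rewrite (eq_bigr (c u)) => [|w /cE //]; rewrite [in X in _ <> X](eq_bigr (c v)).
  exact: sums.
by move=> w /cE.
Qed.

Definition seen_colors (cv : G -> nat) ce v : seq nat :=
  cv v :: [seq ce [set v; w] | w <- enum (adj v)].

Lemma size_seen_colors cv ce v : size (seen_colors cv ce v) = (degree v).+1.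
Proof. by rewrite /= size_map -cardE /degree cardsE. Qed.

Lemma color_sumE cv ce v : color_sum cv ce v = sumn (seen_colors cv ce v).
Proof. by rewrite /color_sum edge_sum /= sumnE big_map big_enum. Qed.

Lemma seen_colors_uniq k cv ce v :
  proper_total_coloring k cv ce -> uniq (seen_colors cv ce v).
Proof.
case=> _ _ ce_adj ce_cv; rewrite /= map_inj_in_uniq ?enum_uniq ?andbT.
  apply/mapP=> -[w]; rewrite mem_enum => vw /esym.
  by apply: ce_cv; rewrite ?set21 ?edge_in_edges.
move=> x y; rewrite !mem_enum => vx vy eq_ce; apply/eqP; apply/idPn => xy.
apply: (ce_adj v [set v; x] [set v; y]);
  rewrite ?edge_in_edges ?set21 // => /set2_cancel xyE.
by rewrite xyE ?eqxx ?adj_neq in xy.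
Qed.

Lemma seen_colors_sub k cv ce v :
  proper_total_coloring k cv ce -> {subset seen_colors cv ce v <= iota 1 k}.
Proof.
case=> -[cvk cek] _ _ _ a; rewrite mem_iota add1n ltnS inE.
case/orP=> [/eqP->|/mapP[w]]; first exact: cvk.
by rewrite mem_enum => vw ->; rewrite cek ?edge_in_edges.
Qed.

Lemma degree_lt_colors k (v : G) : sum_total_colorable G k -> degree v < k.
Proof.
case=> cv [ce [cP _]]; rewrite -(size_seen_colors cv ce) -(size_iota 1 k).
apply: uniq_leq_size (seen_colors_sub cP); exact: seen_colors_uniq cP.
Qed.

(** The inhabitant of [G] forces [0 < k]; the empty graph has maximum degree 0 and needs no
    color. *)
Lemma max_degree_lt_colors k :
  G -> sum_total_colorable G k -> max_degree G < k.
Proof.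
move=> v0 Gk; have k_gt0 := leq_ltn_trans (leq0n _) (degree_lt_colors v0 Gk).
rewrite -(ltn_predK k_gt0) ltnS; apply/bigmax_leqP => v _.
by rewrite -ltnS (ltn_predK k_gt0) degree_lt_colors.
Qed.

Lemma equal_degree_colors k (u v : G) : adj u v -> degree u = degree v ->
  sum_total_colorable G k -> (degree u).+1 < k.
Proof.
move=> uv duv Gk; rewrite ltn_neqAle degree_lt_colors // andbT.
apply/eqP=> ku; case: Gk => cv [ce [cP]] /(_ u v uv); apply.
(* The [k] distinct colors seen at [w] exhaust the [k] available ones, so the sum at [w] is that of
   all colors. *)
have all_seen w : (degree w).+1 = k -> perm_eq (seen_colors cv ce w) (iota 1 k).
  move=> wk; apply: uniq_perm; rewrite ?iota_uniq ?(seen_colors_uniq _ cP) //.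
  have /uniq_min_size/(_ (@seen_colors_sub _ _ _ w cP))[] // :=
    seen_colors_uniq w cP.
  by rewrite size_iota size_seen_colors wk.
rewrite !color_sumE; apply: perm_sumn.
by rewrite (perm_trans (all_seen u _)) // perm_sym all_seen -?duv.
Qed.

End Edges.

(** * Sums over the neighbors in products, paths and wheels *)

Section Sums.

Lemma sum_cart_adj (G H : sgraph) (v : cart_prod G H) (F : cart_prod G H -> nat) :
  \sum_(w | adj v w) F w =
  \sum_(y | adj v.2 y) F (v.1, y) + \sum_(x | adj v.1 x) F (x, v.2).
Proof.
case: v => a b /=; rewrite (eq_bigr (fun w => F (w.1, w.2))) => [|[]//].
rewrite (bigID (fun w : G * H => a == w.1)) /=; congr (_ + _).
  rewrite (eq_bigl (fun w : G * H => (w.1 == a) && adj b w.2)).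
    rewrite -(pair_big (fun x => x == a) (adj b) (fun x y => F (x, y))) /=.
      by rewrite big_pred1_eq.
  move=> [x y] /=; rewrite /cart_adj /= eq_sym; case: eqP => [->|//].
    by rewrite adj_irr orbF andbT.
  by rewrite andbF.
rewrite (eq_bigl (fun w : G * H => adj a w.1 && (w.2 == b))).
  rewrite -(pair_big (adj a) (fun y => y == b) (fun x y => F (x, y))) /=.
  by under eq_bigr do rewrite big_pred1_eq.
move=> [x y] /=; rewrite /cart_adj /= (eq_sym b); case: eqP => [->|//].
  by rewrite adj_irr andbF.
by rewrite andbT.
Qed.

Lemma sum_path_adj n (i : path_graph n) (F : nat -> nat) :
  \sum_(k | adj i k) F k =
  (if i.+1 < n then F i.+1 else 0) + (if 0 < i then F i.-1 else 0).
Proof.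
rewrite (bigID (fun k : 'I_n => i.+1 == k)) /=; congr (_ + _).
  case: ifP => [lt_in|ge_in].
    rewrite (eq_bigl (pred1 (Ordinal lt_in))) ?big_pred1_eq // => k.
    by rewrite /path_adj /= -val_eqE /=; lia.
  by rewrite big_pred0 // => k; rewrite /path_adj /=; have := ltn_ord k; lia.
case: ifP => [i_gt0|i0].
  have lt_in : i.-1 < n by have := ltn_ord i; lia.
  rewrite (eq_bigl (pred1 (Ordinal lt_in))) ?big_pred1_eq // => k.
  by rewrite /path_adj /= -val_eqE /=; lia.
by rewrite big_pred0 // => k; rewrite /path_adj /=; lia.
Qed.

Lemma sum_hub_adj m (F : wheel m -> nat) :
  \sum_(w | adj (None : wheel m) w) F w = \sum_j F (Some j).
Proof.
rewrite (reindex_omap (Some : 'I_m -> wheel m) id) => [|[]//].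
by apply: eq_bigl => j; rewrite /= eqxx.
Qed.

Lemma val_ordS m (j : 'I_m) : ordS j = (if j.+1 < m then j.+1 else 0) :> nat.
Proof.
have := ltn_ord j; rewrite /= leq_eqVlt => /orP[/eqP->|lt_jm].
  by rewrite modnn ltnn.
by rewrite lt_jm modn_small.
Qed.

Lemma ordS_neq m (j : 'I_m) : 1 < m -> ordS j != j.
Proof.
move=> m_gt1; apply/eqP => /(congr1 (@nat_of_ord m)); rewrite val_ordS.
by case: ifP; lia.
Qed.

(** Equivalently, the two rim neighbors of a rim vertex are distinct. *)
Lemma ordSS_neq m (j : 'I_m) : 2 < m -> ordS (ordS j) != j.
Proof.
move=> m_gt2; have lt_jm := ltn_ord j.
apply/eqP => /(congr1 (@nat_of_ord m)); rewrite !val_ordS.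
by do 2?case: ifP; lia.
Qed.

Lemma sum_rim_adj m (j : 'I_m) (F : wheel m -> nat) : 2 < m ->
  \sum_(w | adj (Some j : wheel m) w) F w =
  F None + F (Some (ord_pred j)) + F (Some (ordS j)).
Proof.
move=> m_gt2; have m_gt1 := ltnW m_gt2.
have jE := ord_predK j; have p_j := ordS_neq (ord_pred j) m_gt1.
have p_S := ordSS_neq (ord_pred j) m_gt2; rewrite jE in p_j p_S.
rewrite (bigD1 None) //= (bigD1 (Some (ord_pred j))) /=; last first.
  by rewrite jE eqxx orbT p_j.
rewrite (bigD1 (Some (ordS j))) /=; last first.
  by rewrite eqxx eq_sym ordS_neq.
rewrite big_pred0 ?addn0 ?addnA // => -[k|] //=.
rewrite andbT !(inj_eq Some_inj).
case: (k =P ordS j) => _; rewrite ?andbF //= andbT.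
case: (j =P ordS k) => [->|_]; last by rewrite andbF.
by rewrite ordSK eqxx andbF.
Qed.

End Sums.

(** * Degrees in the product of a wheel and a path *)

Section Degrees.

Lemma degree_sum (G : sgraph) (v : G) : degree v = \sum_(w | adj v w) 1.
Proof. by rewrite sum1_card /degree cardsE. Qed.

Lemma degree_cart (G H : sgraph) (v : cart_prod G H) :
  degree v = degree v.2 + degree v.1.
Proof. by rewrite degree_sum sum_cart_adj -!degree_sum. Qed.

Lemma degree_path n (i : path_graph n) : degree i = (i.+1 < n) + (0 < i).
Proof.
by rewrite degree_sum (sum_path_adj i (fun=> 1)); case: ifP; case: ifP.
Qed.

Lemma degree_hub m : degree (None : wheel m) = m.
Proof. by rewrite degree_sum sum_hub_adj sum1_card card_ord. Qed.

Lemma degree_rim m (j : 'I_m) : 2 < m -> degree (Some j : wheel m) = 3.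
Proof. by move=> m_gt2; rewrite degree_sum sum_rim_adj. Qed.

Lemma max_degree_wheel_path m n : 2 < m -> 1 < n ->
  max_degree (cart_prod (wheel m) (path_graph n)) = m + (if n == 2 then 1 else 2).
Proof.
move=> m_gt2 n_gt1; apply/eqP; rewrite eqn_leq; apply/andP; split.
  apply/bigmax_leqP => -[x i] _; rewrite degree_cart degree_path /= addnC.
  apply: leq_add; last by have := ltn_ord i; case: ifP; lia.
  by case: x => [j|]; rewrite ?degree_hub ?degree_rim.
(* The hub of layer 1 attains the bound: that layer is an inner one as soon as [n > 2]. *)
apply: leq_trans (leq_bigmax (None, Ordinal n_gt1)).
by rewrite degree_cart degree_path degree_hub /=; case: ifP; lia.
Qed.

End Degrees.

(** * Coloring a product with a path layer by layer *)

Definition vertical_sum n (vc : nat -> nat) i :=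
  (if i.+1 < n then vc i else 0) + (if 0 < i then vc i.-1 else 0).

Section Layers.
Variables (G : sgraph) (n : nat).
Let GP := cart_prod G (path_graph n).

Lemma cart_path_adj (w z : GP) : adj w z ->
  [\/ w.1 = z.1 /\ z.2 = w.2.+1 :> nat, w.1 = z.1 /\ w.2 = z.2.+1 :> nat
    | adj w.1 z.1 /\ w.2 = z.2].
Proof.
case/orP=> [/andP[/eqP-> /orP[]/eqP iE]|/andP[xy /eqP ij]].
- by apply: Or31.
- by apply: Or32.
by apply: Or33.
Qed.

(** Among adjacent pairs, equal first coordinates characterize the vertical edges; [minn] selects
    the lower layer, so [vc i] colors all edges between layers [i] and [i.+1]. *)
Definition layered_edges (c : G -> G -> nat) (vc : nat -> nat) (w z : GP) :=
  if w.1 == z.1 then vc (minn w.2 z.2) else c w.1 z.1.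

Lemma sum_layered_edges c vc (w : GP) :
  \sum_(z | adj w z) layered_edges c vc w z =
  vertical_sum n vc w.2 + \sum_(x | adj w.1 x) c w.1 x.
Proof.
rewrite sum_cart_adj; congr (_ + _).
  rewrite /layered_edges /= eqxx (sum_path_adj w.2 (fun k => vc (minn w.2 k))).
  by move: (nat_of_ord w.2) => i; congr (_ + _); case: ifP => // _; congr vc; lia.
apply: eq_bigr => x wx.
by rewrite /layered_edges /= (negPf (adj_neq wx)).
Qed.

(** Inside a layer all sums shift by the same [vertical_sum]. Between layers the contribution of [c]
    cancels, which leaves only vertex colors and vertical sums to compare. *)
Lemma layered_coloring k (cv : nat -> G -> nat) c (vc : nat -> nat) :
  (forall i, i < n -> sum_coloring k (cv i) c) ->
  (forall i, i.+1 < n -> 1 <= vc i <= k) ->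
  (forall i x, i.+1 < n ->
     [/\ cv i x <> cv i.+1 x, vc i <> cv i x & vc i <> cv i.+1 x]) ->
  (forall i x y, i.+1 < n -> adj x y -> c x y <> vc i) ->
  (forall i, i.+2 < n -> vc i <> vc i.+1) ->
  (forall i x, i.+1 < n ->
     cv i x + vertical_sum n vc i <> cv i.+1 x + vertical_sum n vc i.+1) ->
  sum_total_colorable GP k.
Proof.
move=> layer vck vccv vcc vcvc sums.
apply: (@sum_coloring_colorable _ _ (fun w : GP => cv w.2 w.1)
  (layered_edges c vc)).
rewrite /sum_coloring /layered_edges; split; first split.
- by move=> [x i]; have [[] ] := layer i (ltn_ord i).
- move=> [x i] [y j] /cart_path_adj[]/= [xy ij].
  + rewrite xy eqxx; apply: vck; have := ltn_ord j; lia.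
  + rewrite xy eqxx; apply: vck; have := ltn_ord i; lia.
  have [[_ ck] _ _ _ _] := layer i (ltn_ord i).
  by rewrite (negPf (adj_neq xy)); apply: ck.
- split=> -[x i] [y j] /=.
    move=> /cart_path_adj[]/= [xy ij]; rewrite eq_sym ?xy ?eqxx 1?minnC //.
    rewrite eq_sym (negPf (adj_neq xy)).
    by have [_ [cC _] _ _ _] := layer i (ltn_ord i); apply: cC.
  move=> /cart_path_adj[]/= [xy ij]; rewrite ?xy ?eqxx.
  + have lt_j := ltn_ord j; have [|_ + _] := vccv i y; first lia.
    by rewrite (minn_idPl _) // ij.
  + have lt_i := ltn_ord i; have [|_ _] := vccv j y; first lia.
    by rewrite (minn_idPr _) // ij.
  rewrite (negPf (adj_neq xy)); have [_ [_ c_cv] _ _ _] := layer i (ltn_ord i).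
  exact: c_cv.
- move=> [x i] [y j] /cart_path_adj[]/= [xy ij]; rewrite ?xy.
  + by have := ltn_ord j; rewrite ij => /(vccv i y)[].
  + by have := ltn_ord i; rewrite ij => /(vccv j y)[/nesym].
  by have [_ _ + _ _] := layer i (ltn_ord i); rewrite -ij; apply.
- move=> [x i] [y j] [z l] xy xz.
  have := ltn_ord i; have := ltn_ord j; have := ltn_ord l.
  (* Each of the two edges goes up, down or stays in its layer. Two edges in the same vertical
     direction coincide, opposite ones fall under [vcvc], a vertical and a horizontal one under
     [vcc]. *)
  case/cart_path_adj: xy xz => /= [] [xy ij] /cart_path_adj[]/= [xz il] ln jn ni yz;
    rewrite -?xy -?xz ?eqxx ?(negPf (adj_neq xy)) ?(negPf (adj_neq xz)).
  + by case: yz; rewrite -xy -xz; congr pair; apply: val_inj; rewrite /= ij il.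
  + have -> : minn i j = l.+1 by lia.
    have -> : minn i l = l by lia.
    apply/nesym/vcvc; lia.
  + have -> : minn i j = i by lia.
    apply/nesym/vcc => //; lia.
  + have -> : minn i l = j.+1 by lia.
    have -> : minn i j = j by lia.
    apply/vcvc; lia.
  + case: yz; rewrite -xy -xz; congr pair; apply: val_inj; rewrite /=; lia.
  + have -> : minn i j = j by lia.
    apply/nesym/vcc => //; lia.
  + have -> : minn i l = i by lia.
    apply/vcc => //; lia.
  + have -> : minn i l = l by lia.
    apply/vcc => //; lia.
  have [_ _ _ + _] := layer i (ltn_ord i); apply=> // yzE.
  by apply: yz; rewrite yzE -ij -il.
move=> w z wz; rewrite !sum_layered_edges.
case: w z wz => x i [y j] /cart_path_adj[]/= [xy ij]; rewrite ?xy.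
- have := ltn_ord j; rewrite ij => lt_in; have := sums i y lt_in; lia.
- have := ltn_ord i; rewrite ij => lt_jn; have := sums j y lt_jn; lia.
have [_ _ _ _] := layer i (ltn_ord i); move=> /(_ _ _ xy); rewrite -ij; lia.
Qed.

(* Consecutive inner layers carry the same edge colors, so there the sums differ
   because the vertex colors do; an end layer misses a vertical color, which
   exceeds every vertex color. *)
Lemma alternating_layers l (cv : bool -> G -> nat) c :
  (forall b, sum_coloring l (cv b) c) -> (forall x, cv true x <> cv false x) ->
  sum_total_colorable GP (if n == 2 then l.+1 else l.+2).
Proof.
(* Two colors above [l] suffice for the vertical edges; when [n] is 2 only [l.+1] occurs. *)
move=> cvP cvTF; pose vc i := l.+1 + odd i.
have cv_le b x : 1 <= cv b x <= l by case: (cvP b) => -[].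
have cv_odd i x : cv (odd i) x <> cv (odd i.+1) x.
  by rewrite /=; case: (odd i); [|apply: nesym]; apply: cvTF.
have wider b : sum_coloring (if n == 2 then l.+1 else l.+2) (cv b) c.
  case: (cvP b) => -[vl cl] ? ? ? ?; split=> //; split.
    by move=> x; have := vl x; case: ifP; lia.
  by move=> x y /cl; case: ifP; lia.
apply: (@layered_coloring _ (fun i => cv (odd i)) c vc) => //.
- by rewrite /vc => i; case: ifP => [/eqP->|]; case: i => //=; lia.
- move=> i x _; split=> //; rewrite /vc.
    by have := cv_le (odd i) x; lia.
  by have := cv_le (odd i.+1) x; lia.
- move=> i x y _ xy; case: (cvP true) => -[_ /(_ _ _ xy) + _ _ _ _].
  by rewrite /vc; lia.
- by rewrite /vc => i _ /=; case: odd => /=; lia.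
move=> i x lt_in; have := cv_odd i x; have := cv_le (odd i) x.
have := cv_le (odd i.+1) x; rewrite /vertical_sum lt_in /vc /=.
by case: i lt_in => [|i] /= lt_in; last case: (odd i) => /=; case: ifP; lia.
Qed.

End Layers.

(** * Coloring a single wheel *)

Section Wheel.
Variable m : nat.
Hypothesis m_gt2 : 2 < m.

Definition wheel_vertices (h : nat) (r : nat -> nat) (x : wheel m) : nat :=
  if x is Some j then r j else h.

(** For adjacent rim vertices the [else] branch is the case [i = ordS j]; since [m > 2], both cases
    cannot hold at once. *)
Definition wheel_edges (s e : nat -> nat) (x y : wheel m) : nat :=
  match x, y with
  | None, None => 0
  | None, Some j => s j
  | Some i, None => s i
  | Some i, Some j => if j == ordS i then e i else e j
  end.

(* The rim edge between [j] and its successor is [e j]. *)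
Record rim_coloring (s e r : nat -> nat) : Prop := RimColoring {
  spoke_inj : {in gtn m &, injective s};
  rim_local (i : 'I_m) (j := ordS i) :
    [/\ [/\ e i <> s i, e i <> s j & e i <> e j],
        [/\ e i <> r i & e i <> r j], r i <> s i & r i <> r j];
  rim_sums (i : 'I_m) (j := ordS i) (l := ordS j) :
    r j + s j + e i <> r l + s l + e l }.

Lemma rim_adj (i j : 'I_m) : adj (Some i : wheel m) (Some j) ->
  j = ordS i \/ i = ordS j.
Proof. by case/andP=> _ /orP[]/eqP ->; [left|right]. Qed.

Lemma wheel_edges_succ s e i : wheel_edges s e (Some i) (Some (ordS i)) = e i.
Proof. by rewrite /= eqxx. Qed.

Lemma wheel_edges_pred s e i : wheel_edges s e (Some (ordS i)) (Some i) = e i.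
Proof. by rewrite /= eq_sym (negPf (ordSS_neq i m_gt2)). Qed.

Lemma sum_wheel_edges_rim s e i :
  \sum_(x | adj (Some (ordS i) : wheel m) x) wheel_edges s e (Some (ordS i)) x =
  s (ordS i) + e i + e (ordS i).
Proof.
by rewrite sum_rim_adj // ordSK wheel_edges_succ wheel_edges_pred.
Qed.

Lemma wheel_coloring k s e r h :
  (forall j, j < m -> [/\ 1 <= s j <= k, 1 <= e j <= k & 1 <= r j <= k]) ->
  1 <= h <= k -> rim_coloring s e r ->
  (forall j, j < m -> h <> s j /\ h <> r j) ->
  (forall i : 'I_m, h + \sum_(j < m) s j <>
    r (ordS i) + s (ordS i) + e i + e (ordS i)) ->
  sum_coloring k (wheel_vertices h r) (wheel_edges s e).
Proof.
move=> bounds hk [s_inj loc sums] h_neq hub_sum.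
have symS x y : adj x y -> wheel_edges s e x y = wheel_edges s e y x.
  case: x y => [i|] [j|] // /rim_adj[]->;
  by rewrite wheel_edges_succ wheel_edges_pred.
(* Once a rim vertex is written [ordS j], its rim edges have colors [e j] and [e (ordS j)]. *)
have rimS i : exists j : 'I_m, i = ordS j by exists (ord_pred i); rewrite ord_predK.
split; first split.
- by case=> [j|] //=; have [] := bounds j (ltn_ord j).
- case=> [i|] [j|] //=.
  + have [_ ? _] := bounds i (ltn_ord i); have [_ ? _] := bounds j (ltn_ord j).
    by case: ifP.
  + by have [] := bounds i (ltn_ord i).
  + by have [] := bounds j (ltn_ord j).
- split=> // -[i|] [j|] //.
  + case/rim_adj=> ->; rewrite ?wheel_edges_succ ?wheel_edges_pred /=.
      by have [_ [] ] := loc i.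
    by have [_ [] ] := loc j.
  + by have [_ _ /nesym] := loc i.
  + by have [/nesym] := h_neq j (ltn_ord j).
- case=> [i|] [j|] //=.
  + case/rim_adj=> ->; first by have [] := loc i.
    by have [_ _ _ /nesym] := loc j.
  + by have [_ /nesym] := h_neq i (ltn_ord i).
  + by have [] := h_neq j (ltn_ord j).
- case=> [j|] [i|] [l|] //; last first.
  + move=> _ _ il /s_inj; rewrite !inE => /(_ (ltn_ord i) (ltn_ord l)) eq_il.
    by apply: il; congr Some; apply: val_inj.
  + move=> _ /rim_adj[]->; rewrite ?wheel_edges_succ ?wheel_edges_pred /=.
      by have [[/nesym]] := loc j.
    by have [[_ /nesym]] := loc l.
  + move=> /rim_adj[]-> _; rewrite ?wheel_edges_succ ?wheel_edges_pred /=.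
      by have [[]] := loc j.
    by have [[_]] := loc i.
  move=> /rim_adj[]iE /rim_adj[]lE il.
  + by rewrite iE lE in il.
  + rewrite iE {}lE wheel_edges_succ wheel_edges_pred.
    by have [[_ _ /nesym]] := loc l.
  + rewrite {}lE iE wheel_edges_succ wheel_edges_pred.
    by have [[_ _]] := loc i.
  by case: il; congr Some; apply: (@ordS_inj m); rewrite -iE -lE.
(* The color of the edge joining the two vertices occurs in both sums and is already cancelled in
   [rim_sums]. *)
have rim_ineq i : wheel_vertices h r (Some (ordS i)) +
    \sum_(x | adj (Some (ordS i) : wheel m) x) wheel_edges s e (Some (ordS i)) x
  <> wheel_vertices h r (Some (ordS (ordS i))) +
    \sum_(x | adj (Some (ordS (ordS i)) : wheel m) x)
      wheel_edges s e (Some (ordS (ordS i))) x.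
  by rewrite !sum_wheel_edges_rim /=; have /= := sums i; lia.
have hub_ineq i : wheel_vertices h r None +
    \sum_(x | adj (None : wheel m) x) wheel_edges s e None x
  <> wheel_vertices h r (Some i) +
    \sum_(x | adj (Some i : wheel m) x) wheel_edges s e (Some i) x.
  have [j ->] := rimS i; rewrite sum_wheel_edges_rim sum_hub_adj /=.
  by have /= := hub_sum j; lia.
case=> [i|] [j|] //.
- case/rim_adj=> ->; first by have [p ->] := rimS i; apply: rim_ineq.
  by have [p ->] := rimS j; apply/nesym/rim_ineq.
by move=> _; apply/nesym/hub_ineq.
Qed.

(* Every color is at most [m] except for that of a rim edge, which may also be
   [m.+1]; hence any color above [m] is available for the hub. *)
Record rim_scheme (s e : nat -> nat) (r : bool -> nat -> nat) : Prop := RimScheme {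
  scheme_rim b : rim_coloring s e (r b);
  scheme_alt j : j < m -> r true j <> r false j;
  scheme_le j : j < m ->
    [/\ 1 <= s j <= m, 1 <= e j <= m.+1 & forall b, 1 <= r b j <= m];
  scheme_sum b (i : 'I_m) :
    r b (ordS i) + s (ordS i) + e i + e (ordS i) <= m + \sum_(j < m) s j }.

(** By [scheme_sum] every rim sum is at most [m] plus the sum of the spokes, hence below the hub
    sum. *)
Lemma scheme_coloring s e r b h k : rim_scheme s e r -> m < h <= k ->
  sum_coloring k (wheel_vertices h (r b)) (wheel_edges s e).
Proof.
move=> [rimP _ le_m sums] hk; apply: wheel_coloring => //; first 1 last.
- by lia.
- by move=> j /le_m[? _ /(_ b)]; lia.
- by move=> i; have /= := sums b i; lia.
by move=> j /le_m[? ? /(_ b)]; split; lia.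
Qed.

Lemma scheme_three_layers s e r : rim_scheme s e r ->
  sum_total_colorable (cart_prod (wheel m) (path_graph 3)) m.+3.
Proof.
move=> sP; have [_ alt le_m _] := sP.
(* The vertical colors are [m.+2], then [m.+3]. Each outer hub takes the one it misses; the middle
   hub takes [m.+1], otherwise used only on rim edges. *)
pose h := nth 0 [:: m.+3; m.+1; m.+2].
pose cv i := wheel_vertices (h i) (r (odd i)).
apply: (@layered_coloring _ _ _ cv (wheel_edges s e) (fun i => m.+2 + i)).
- by move=> i lt_i3; apply: scheme_coloring sP _; case: i lt_i3 => [|[|[|]]];
    rewrite /h //=; lia.
- by move=> i; lia.
- move=> [|[]] // [j|] _ /=; rewrite /h /=; try by split; lia.
    have [_ _ r_le] := le_m j (ltn_ord j); have := alt j (ltn_ord j).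
    by have := r_le true; have := r_le false; split; lia.
  have [_ _ r_le] := le_m j (ltn_ord j); have := alt j (ltn_ord j).
  by have := r_le true; have := r_le false; split; lia.
- move=> i [j|] [l|] _ //= => [|_|_].
  + have [_ ? _] := le_m j (ltn_ord j); have [_ ? _] := le_m l (ltn_ord l).
    by case: ifP; lia.
  + by have [? _ _] := le_m j (ltn_ord j); lia.
  + by have [? _ _] := le_m l (ltn_ord l); lia.
- by move=> i; lia.
(* A middle vertex gets both vertical colors, [2m + 5] in total, plus a positive color; an outer
   vertex color and its single vertical color add up to at most [2m + 5]. *)
move=> [|[]] // [j|] _; rewrite /vertical_sum /cv /h /=; try lia.
  have [_ _ r_le] := le_m j (ltn_ord j).
  by have := r_le true; have := r_le false; lia.
have [_ _ r_le] := le_m j (ltn_ord j).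
by have := r_le true; have := r_le false; lia.
Qed.

(** The hub colors alternate between [m.+1] and [m.+2], so [alternating_layers] applies with
    [l = m.+2]. *)
Lemma scheme_layers n s e r : rim_scheme s e r ->
  sum_total_colorable (cart_prod (wheel m) (path_graph n))
    (if n == 2 then m.+3 else m.+4).
Proof.
move=> sP; apply: (@alternating_layers _ _ _
  (fun b : bool => wheel_vertices (m.+1 + b) (r b)) (wheel_edges s e)) => [b|].
  by apply: scheme_coloring sP _; case: b; lia.
by case=> [j|] /=; [have [_ alt _ _] := sP; apply: alt | lia].
Qed.

End Wheel.

(* Modulo [m] the rim vertex [j] and its edges use [j, ..., j + 4] (shifted by
   one), so that consecutive rim sums differ by [4] modulo [m]. *)
Section CyclicScheme.
Variable m : nat.
Hypothesis m_ge5 : 5 <= m.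

(** This is [(j + c) %% m + 1] for [j, c < m], kept linear in each case for [lia]. *)
Definition cyclic_color (c j : nat) := (if j + c < m then j + c else j + c - m).+1.

Lemma cyclic_scheme : rim_scheme m succn (cyclic_color 2)
  (fun b => if b then cyclic_color 3 else cyclic_color 4).
Proof.
(* A rim sum has four terms, each at most [m], so this bound yields [scheme_sum]; it is an equality
   at [m = 5]. *)
have sum_succ : 3 * m <= \sum_(j < m) j.+1.
  rewrite -(subnKC m_ge5); elim: (m - 5) => [|p IHp].
    by rewrite !big_ord_recr big_ord0.
  by rewrite addnS big_ord_recr mulnS addnC leq_add.
have step (i : 'I_m) : (ordS i = i.+1 :> nat /\ i.+1 < m) \/
    (ordS i = 0 :> nat /\ i.+1 = m).
  by have := ltn_ord i; rewrite val_ordS; case: ifP; lia.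
split.
- move=> b; split=> [i j _ _ [] // | i | i]; cbv zeta.
    case: (step i) => -[-> lt_im]; rewrite /cyclic_color.
      by case: b; repeat split; repeat case: ifP; lia.
    by case: b; repeat split; repeat case: ifP; lia.
  by case: b (step i) (step (ordS i)) => -[] [-> lt_im] [] [-> lt_jm];
    rewrite /cyclic_color; repeat case: ifP; lia.
- by rewrite /cyclic_color => j lt_jm; repeat case: ifP; lia.
- rewrite /cyclic_color => j lt_jm.
  by split=> [||[]]; repeat case: ifP; lia.
move=> b i; case: (step i) => -[-> lt_im]; rewrite /cyclic_color.
  by case: b; repeat case: ifP; lia.
by case: b; repeat case: ifP; lia.
Qed.

End CyclicScheme.

Definition table (t : seq nat) (j : nat) : nat := nth 0 t j.

(** Every rim vertex meets exactly one rim edge of color 5, so two of the colors 1 to 4 remain free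
    there, one for each vertex coloring. *)
Lemma scheme4 : rim_scheme 4 (table [:: 1; 2; 3; 4]) (table [:: 5; 1; 5; 2])
  (fun b => table (if b then [:: 3; 4; 2; 1] else [:: 4; 3; 4; 3])).
Proof.
split.
- move=> b; split; first by move=> [|[|[|[|]]]] // [|[|[|[|]]]].
    by case: b => -[[|[|[|[|]]]]].
  by case: b => -[[|[|[|[|]]]]].
- by move=> [|[|[|[|]]]].
- by move=> [|[|[|[|]]]] // _; split=> // -[].
by rewrite !big_ord_recr big_ord0; case=> -[[|[|[|[|]]]]].
Qed.

(* Read off the proper edge coloring [x + y mod 5] of the complete graph on
   [Z/5]: the hub is [0], the rim is [1, 2, 3], and the vertex colors of the two
   kinds of layers are the colors of the edges to [4] and the missing colors. *)
Lemma wheel3_coloring b :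
  sum_coloring 5
    (@wheel_vertices 3 (if b then 4 else 5)
       (table (if b then [:: 5; 1; 2] else [:: 2; 4; 1])))
    (wheel_edges (table [:: 1; 2; 3]) (table [:: 3; 5; 4])).
Proof.
apply: wheel_coloring => //.
- by case: b => -[|[|[|]]].
- by case: b.
- split; first by move=> [|[|[|]]] // [|[|[|]]].
    by case: b => -[[|[|[|]]]].
  by case: b => -[[|[|[|]]]].
- by case: b => -[|[|[|]]].
by rewrite !big_ord_recr big_ord0; case: b => -[[|[|[|]]]].
Qed.

(** * Assembling the bounds *)

Lemma wheel_path_colorable m n : 3 <= m ->
  sum_total_colorable (cart_prod (wheel m) (path_graph n))
    (if n == 2 then m.+3 else m.+4).
Proof.
case: m => [|[|[|[|[|m]]]]] // _.
- by apply: (alternating_layers _ wheel3_coloring) => -[[[|[|[|]]]]|].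
- exact: scheme_layers scheme4.
exact: (scheme_layers _ _ (@cyclic_scheme m.+4.+1 isT)).
Qed.

Lemma wheel_path3_colorable m : 4 <= m ->
  sum_total_colorable (cart_prod (wheel m) (path_graph 3)) m.+3.
Proof.
case: m => [|[|[|[|[|m]]]]] // _; first exact: scheme_three_layers scheme4.
exact: (scheme_three_layers _ (@cyclic_scheme m.+4.+1 isT)).
Qed.

(** For [n = 3] only [m = 3] remains, where hub and rim vertices of the middle layer all have degree
    5. Otherwise two consecutive hubs serve. *)
Lemma wheel_path_adjacent_max m n : 3 <= m -> 2 <= n ->
  ~~ ((n == 3) && (4 <= m)) ->
  let G := cart_prod (wheel m) (path_graph n) in
  exists u v : G,
    [/\ adj u v, degree u = max_degree G & degree v = max_degree G].
Proof.
move=> m_ge3 n_ge2 not34 G; rewrite max_degree_wheel_path //.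
have [nE | n_neq3] := eqVneq n 3.
  have mE : m = 3 by move: not34; rewrite nE; lia.
  rewrite {}/G {not34 m_ge3 n_ge2} mE nE.
  exists (None, inord 1), (Some ord0, inord 1).
  rewrite !degree_cart !degree_path /= degree_hub degree_rim //.
  by rewrite inordK //; split=> //; apply/orP; right; rewrite /= eqxx.
(* The layers are 0 and 1 if [n = 2], and the inner layers 1 and 2 if [n >= 4]. *)
have lt_i : (n != 2).+1 < n by lia.
exists (None, Ordinal (ltnW lt_i)), (None, Ordinal lt_i).
rewrite !degree_cart !degree_path /= degree_hub.
by split; [apply/orP; left; rewrite /= /path_adj eqxx | case: ifP; lia..].
Qed.

Theorem theorem4p5 (m n : nat) (hm : 3 <= m) (hn : 2 <= n) :
  let G := cart_prod (wheel m) (path_graph n) in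
  is_chi_sigma G
    (if (n == 3) && (4 <= m) then (max_degree G).+1 else (max_degree G).+2).
Proof.
move=> G; split.
  rewrite max_degree_wheel_path //; case: ifP => [/andP[/eqP nE m_ge4]|_].
    by rewrite /G nE addn2; apply: wheel_path3_colorable.
  by have := wheel_path_colorable n hm; case: ifP; rewrite ?addn1 ?addn2.
move=> j Gj; case: ifP => [_|/negbT not34].
  by apply: max_degree_lt_colors Gj; exact: (None, Ordinal hn).
have [u [v [uv du dv]]] := wheel_path_adjacent_max hm hn not34.
by rewrite -du; apply: equal_degree_colors uv _ Gj; rewrite du dv.
Qed.
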